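(* Let $(\delta^*,\pi^* )$ be an optimal solution to the problem (NoLoss) \begin{align*} \max\quad &\sum_{i\in I} v_i(\delta_i)\\ \text{s.t.}\quad &\sum_{i\in I} f_{i,t}(\delta_i)=0 \quad \forall t\in T,\\ &\delta_i\in D_i \ \text{ and }\ v_i(\delta_i)-\pi^\top f_i(\delta_i)\ge 0\quad \forall i\in I, \end{align*} whose variables are $\delta=(\delta_i)_{i\in I}$ and $\pi\in\mathbb{R}^T$. Then $(\delta^*,\pi^* )$ is an efficient solution to the multicriteria problem (Multi).
   Context: $T$ is a finite set of commodities (without money) and $I$ is a finite set of participants. Each participant $i\in I$ has bid parameters $(D_i,v_i,f_i)$: a decision set $D_i\subseteq\mathbb{R}^{n_i}$, a decision valuation $v_i:D_i\to\mathbb{R}$ and a quantity function $f_i=(f_{i,t})_{t\in T}:D_i\to\mathbb{R}^T$. For a price vector $\pi\in\mathbb{R}^T$, the surplus of participant $i$ at $\delta_i\in D_i$ is $v_i(\delta_i)-\pi^\top f_i(\delta_i)$. The multicriteria problem (Multi) is to maximize the vector $\big(v_i(\delta_i)-\pi^\top f_i(\delta_i)\big)_{i\in I}$ over all $(\delta,\pi)$ that are feasible, i.e. satisfy $\sum_{i\in I} f_{i,t}(\delta_i)=0$ for all $t\in T$, $\delta_i\in D_i$ for all $i\in I$, and $\pi\in\mathbb{R}^T$. A feasible tuple $(\delta^*,\pi^* )$ of (Multi) is an efficient solution to (Multi) if there is no other feasible $(\delta,\pi)$ of (Multi) with $v_i(\delta_i)-\pi^\top f_i(\delta_i)\ge v_i(\delta_i^*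 )-(\pi^* )^\top f_i(\delta_i^* )$ for all $i\in I$ and $v_i(\delta_i)-\pi^\top f_i(\delta_i)> v_i(\delta_i^* )-(\pi^* )^\top f_i(\delta_i^* )$ for some $i\in I$. *)

(* Defs.v *)
From mathcomp Require Import all_boot all_order all_algebra.
From mathcomp Require Import classical_sets reals.

Set Implicit Arguments.
Unset Strict Implicit.
Unset Printing Implicit Defensive.

Import Order.TTheory GRing.Theory Num.Theory.
Local Open Scope ring_scope.

(* [valuation] and [quantity] stand for functions defined on [decisions] only.
   They are total here, but feasibility below always requires the decisions to
   lie in [decisions], so their values elsewhere are irrelevant. *)
Record bid (R : realType) (T : finType) := Bid {
  dim : nat;
  decisions : set 'rV[R]_dim;
  valuation : 'rV[R]_dim -> R;
  quantity : 'rV[R]_dim -> T -> R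
}.

Section Market.
Variables (R : realType) (T I : finType) (b : I -> bid R T).

Definition profile := forall i : I, 'rV[R]_(dim (b i)).

Implicit Types (delta : profile) (pi : T -> R).

Definition surplus pi delta (i : I) : R :=
  valuation (delta i) - \sum_(t : T) pi t * quantity (delta i) t.

Definition balanced delta : Prop :=
  forall t : T, \sum_(i : I) quantity (delta i) t = 0.

(* The prices are free: feasibility does not constrain [pi]. *)
Definition multi_feasible delta pi : Prop :=
  balanced delta /\ (forall i : I, decisions (delta i)).

(* A dominating pair is automatically distinct from [(delta', pi')], because
   one of its surpluses is strictly larger. *)
Definition efficient delta' pi' : Prop :=
  multi_feasible delta' pi' /\
  ~ (exists delta pi,
       [/\ multi_feasible delta pi,
           forall i : I, surplus pi delta i >= surplus pi' delta' i &
           exists i : I, surplus pi delta i > surplus pi' delta' i]).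

Definition noloss_feasible delta pi : Prop :=
  balanced delta /\
  (forall i : I, decisions (delta i) /\ surplus pi delta i >= 0).

Definition welfare delta : R := \sum_(i : I) valuation (delta i).

Definition noloss_optimal delta' pi' : Prop :=
  noloss_feasible delta' pi' /\
  (forall delta pi, noloss_feasible delta pi -> welfare delta <= welfare delta').

End Market.

(* Main.v *)
(* In a balanced profile the payments cancel across participants, so the total
   surplus equals the welfare whatever the prices are. A dominating pair has
   surpluses at least those of the (NoLoss) optimum, hence nonnegative, so it is
   feasible for (NoLoss), and its welfare would be strictly larger. *)
Require Import Defs.
From mathcomp Require Import all_boot all_order all_algebra.
From mathcomp Require Import classical_sets reals.

Import Order.TTheory GRing.Theory Num.Theory.

(** After the two sums are exchanged, each price [pi t] factors out of the total quantity of [t],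
    which balance makes zero. *)
Lemma sum_surplus_balanced (R : realType) (T I : finType) (b : I -> bid R T)
    (delta : profile b) (pi : T -> R) :
  balanced delta -> (\sum_(i : I) surplus pi delta i)%R = welfare delta.
Proof.
move=> bal; rewrite /surplus sumrB exchange_big /= [X in (_ - X)%R]big1 ?subr0//.
by move=> t _; rewrite -mulr_sumr bal mulr0.
Qed.

Theorem proposition32 (R : realType) (T I : finType) (b : I -> bid R T)
    (delta : profile b) (pi : T -> R) :
  noloss_optimal delta pi -> efficient delta pi.
Proof.
move=> [[bal feas] opt]; split; first by split=> // i; case: (feas i).
move=> [delta2 [pi2 [[bal2 dec2] dom [j ltj]]]].
have feas2 : noloss_feasible delta2 pi2.
  by split=> // i; split=> //; apply: le_trans (dom i); case: (feas i).
have := opt _ _ feas2.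
(* Each welfare becomes a total surplus at its own prices, [pi2] or [pi], so that [dom] and [ltj]
   apply term by term. *)
rewrite -(sum_surplus_balanced _ _ _ _ _ pi2 bal2).
rewrite -(sum_surplus_balanced _ _ _ _ _ pi bal) leNgt => /negP; apply.
(* Splitting off [j] leaves a strict inequality there and weak ones elsewhere. *)
by rewrite (bigD1 j) //= [ltRHS](bigD1 j) //= ltr_leD // ler_sum.
Qed.
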